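(* Let $d\in\mathbb{N}$ and $\varepsilon>0$. Let $f\in\mathbb{R}[p_2,p_3,\ldots,p_{2d}]$ (i.e. $f$ is a symmetric function in which $p_1$ does not appear) be homogeneous of degree $2d$, and suppose that $f(x)\geq\varepsilon$ for all $x\in\mathbb{R}^\infty$ with $p_2(x)=1$. Then there exists $k\in\mathbb{N}_0$ such that $p_2^k f$ is an any-dimensional sum of squares.
   Context: $\mathbb{N}$ denotes the positive integers and $\mathbb{N}_0=\mathbb{N}\cup\{0\}$. For $k\geq 1$ let $p_k=\sum_{i=1}^\infty X_i^k$ be the $k$-th power sum function in countably many variables $X_1,X_2,\ldots$; the $p_k$ are algebraically independent, and $p_k$ is homogeneous of degree $k$ (in the variables $X_i$). $\Lambda=\mathbb{R}[p_1,p_2,\ldots]$ is the ring of symmetric functions. For $f\in\Lambda$, $f^{(n)}=f(X_1,\ldots,X_n,0,0,\ldots)\in\mathbb{R}[X_1,\ldots,X_n]$ denotes its truncation to $n$ variables. $\mathbb{R}^\infty$ is the set of real sequences with only finitely many non-zero entries. A symmetric function $g$ is an any-dimensional sum of squares if, for every $n\in\mathbb{N}$, $g^{(n)}$ is a sum of squares of polynomials in $\mathbb{R}[X_1,\ldots,X_n]$. *)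

(* Defs.v *)
From HB Require Import structures.
From mathcomp Require Import all_boot all_order all_algebra finmap.
From mathcomp Require Import -(notations) monalg.
From mathcomp Require Import mpoly.

Set Implicit Arguments.
Unset Strict Implicit.
Unset Printing Implicit Defensive.

Import GRing.Theory.
Local Open Scope ring_scope.

(* The ring R[p_1, p_2, ...] in countably many algebraically independent
   generators. Generators are indexed by [nat], that of index [i] being
   p_(i+1), hence the shifts below. *)
Definition symfun (R : comNzRingType) : Type := malg (cmonom nat) R.

(* The power sum p_k, for k >= 1 only. *)
Definition psum (R : comNzRingType) (k : nat) : symfun R :=
  mkmalgU (ucm k.-1) 1.

(* The value of a monomial in the p_k when each p_k is replaced by [p k]. *)
Definition subst_monom (S : comNzRingType) (p : nat -> S) (m : cmonom nat) :
    S :=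
  \prod_(i <- finsupp m) p i.+1 ^+ m i.

Lemma subst_monomEw (S : comNzRingType) (p : nat -> S) (m : cmonom nat)
  (D : {fset nat}) : (finsupp m `<=` D)%fset ->
  subst_monom p m = \prod_(i <- D) p i.+1 ^+ m i.
Proof.
move=> le; rewrite /subst_monom (big_fset_incl _ le) //.
by move=> i _; rewrite -cmE_neq0 negbK => /eqP ->; rewrite expr0.
Qed.

Lemma subst_monom_mmorphism (S : comNzRingType) (p : nat -> S) :
  mmorphism (subst_monom p).
Proof.
split=> [m1 m2|]; last by rewrite /subst_monom mdom1 big_seq_fset0.
rewrite {1}/subst_monom mdomD.
rewrite (subst_monomEw p (fsubsetUl _ (finsupp m2))).
rewrite (subst_monomEw p (fsubsetUr (finsupp m1) _)).
by rewrite -big_split /=; apply: eq_bigr => i _; rewrite cmM exprD.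
Qed.

HB.instance Definition _ (S : comNzRingType) (p : nat -> S) :=
  isMultiplicative.Build (cmonom nat) S (subst_monom p)
    (subst_monom_mmorphism p).

Lemma subst_monom_ucm (S : comNzRingType) (p : nat -> S) (i : nat) :
  subst_monom p (ucm i) = p i.+1.
Proof. by rewrite /subst_monom mdomU big_seq_fset1 cmUU expr1. Qed.

(* The truncation f^(n) = f(X_1, ..., X_n, 0, 0, ...). *)
Definition trunc (R : comNzRingType) (n : nat) (f : symfun R) : {mpoly R[n]} :=
  monalg.mmap (@mpolyC n R) (subst_monom (fun k => \sum_(j < n) 'X_j ^+ k)) f.

Lemma trunc_psum (R : comNzRingType) (n k : nat) : (0 < k)%N ->
  trunc n (psum R k) = \sum_(j < n) 'X_j ^+ k.
Proof.
case: k => // k _; rewrite /trunc /psum monalg.mmapU /= mpolyC1 mul1r.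
exact: subst_monom_ucm.
Qed.

(* R^oo: sequences with finitely many non-zero entries. *)
Definition finseq (R : nzRingType) := {fsfun nat -> R with 0}.

Definition seval (R : comNzRingType) (x : finseq R) (f : symfun R) : R :=
  monalg.mmap idfun
    (subst_monom (fun k => \sum_(j <- finsupp x) x j ^+ k)) f.

Lemma seval_psum (R : comNzRingType) (x : finseq R) (k : nat) : (0 < k)%N ->
  seval x (psum R k) = \sum_(j <- finsupp x) x j ^+ k.
Proof.
case: k => // k _; rewrite /seval /psum monalg.mmapU mul1r.
exact: subst_monom_ucm.
Qed.

(* f lies in the subring R[p_a, ..., p_b]. *)
Definition in_psums (R : comNzRingType) (a b : nat) (f : symfun R) : Prop :=
  forall m : cmonom nat, m \in monalg.msupp f ->
  forall i : nat, i \in finsupp m -> (a <= i.+1 <= b)%N.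

(* Homogeneity in the variables X_i, so that p_k has degree k. *)
Definition homogeneous (R : comNzRingType) (e : nat) (f : symfun R) : Prop :=
  forall n : nat, trunc n f \is e.-homog.

Definition sum_of_squares (R : comNzRingType) (n : nat) (g : {mpoly R[n]}) :
    Prop :=
  exists s : seq {mpoly R[n]}, g = \sum_(q <- s) q ^+ 2.

Definition any_dim_sos (R : comNzRingType) (g : symfun R) : Prop :=
  forall n : nat, (0 < n)%N -> sum_of_squares (trunc n g).

(* Main.v *)
Require Import Defs.
From mathcomp Require Import all_boot all_order all_algebra reals.
From mathcomp Require Import -(notations) monalg.
From mathcomp Require Import finmap mpoly qpoly ring lra zify.

Import Order.TTheory GRing.Theory Num.Theory.
Local Open Scope ring_scope.

Set Implicit Arguments.
Unset Strict Implicit.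
Unset Printing Implicit Defensive.

(** The proof is a form of Pólya's theorem whose constants do not see the number
n of variables.

On the sphere p_2 = 1 the squares x_i^2 are a probability distribution on the
indices, and p_k = sum_i x_i^2 x_i^(k-2) is the mean of x_i^(k-2) over a random
index. So f is the mean of a statistic of D independent samples. In general let
y be weights on a finite alphabet A and H = sum_u G(u) y_(u_1)...y_(u_D) a form
given by a statistic G on words of length D with |G| <= B. Then the coefficient
of a word W of length N in (sum y)^(N-D) H is the average of G over the samples
without replacement from W; up to an error of order B D^2 / N it is the average over the
samples with replacement, and this is the value of H at the letter frequencies
of W. Hence if H >= delta on all probability distributions on A, all
coefficients are nonnegative as soon as N >= B D^2 / delta ([polya_words]). Only
B, D and delta enter, not the size of A.

Two things must be arranged to apply this to f.

Odd powers of x_i are not functions of x_i^2. A letter is therefore an index i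
together with r tosses of a coin of bias x_i: its weight is
x_i^2 prod_j (1 +- x_i)/2. This is a sum of squares modulo p_2 = 1, because
1 +- x_i = ((1 +- x_i)^2 + sum_(j != i) x_j^2) / 2 there. The elementary symmetric
means of the tosses ([coin_moment]) have mean x_i^k exactly, and they differ from
the k-th power of the mean toss by O(k^2 / r), by the same comparison of
samples.

A distribution q on the letters need not come from a point of the sphere, and
then f may be negative at q. Let w, v, u, z be the masses of the letters over an
index i, weighted by tau^0, tau^1, tau^2, tau^4 for tau the mean toss. The form
Z = sum_i (w^3 - w u - v^2 + z) vanishes on the weights y, where each of the four
terms is p_6. On an arbitrary q it is the sum of the nonnegative quantities
sum q (tau^2 - w)^2 and sum_i (w u - v^2), which measure how far tau^2 is from w
and how much tau varies over an index. The point x_i = +- sqrt w_i, with the sign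
of v_i, is on the sphere, and the mean of |tau - x_i| is at most a small constant
plus a constant times Z ([deviation_le]). In the form that is sampled, the powers
of tau are replaced by the elementary symmetric means of the tosses. So
f + C Z >= eps / 2 on all distributions for a suitable C ([plugin_bound]), and
f + C Z = f on the weights.

To work with homogeneous polynomials, 1 is replaced by a square root s of p_2;
[uniform_sos] is stated in any commutative ring that contains one. It is applied
in R[X][s] / (s^2 - p_2), whose elements are a + b s: the constant term of the
square of such an element is a^2 + p_2 b^2, a sum of squares. *)

(** * Sampling from words *)

Lemma ffact_le_expn (N D : nat) : (N ^_ D <= N ^ D)%N.
Proof.
elim: D => [|k IHk]; first by rewrite ffactn0 expn0.
by rewrite ffactnSr expnSr leq_mul // leq_subr.
Qed.

(** At most a fraction D^2 / N of the maps from D points to N points fails to be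
injective. *)
Lemma expn_sub_ffact_le (D N : nat) :
  ((N ^ D - N ^_ D) * N <= D ^ 2 * N ^ D)%N.
Proof.
elim: D => [|D IH]; first by rewrite ffactn0 expn0 subnn.
have le := ffact_le_expn N D.
rewrite ffactnSr expnSr.
have h : (N ^_ D * (N - D) + N ^_ D * D >= N ^_ D * N)%N.
  by rewrite -mulnDr leq_mul2l; apply/orP; right; lia.
have h2 : (N ^_ D * D <= N ^ D * D)%N by rewrite leq_mul2r le orbT.
have h3 : ((N ^ D * N - N ^_ D * (N - D))
    <= (N ^ D - N ^_ D) * N + N ^ D * D)%N.
  by rewrite mulnBl; nia.
apply: (leq_trans (leq_mul h3 (leqnn N))).
rewrite mulnDl mulnA.
apply: (@leq_trans (D ^ 2 * N ^ D * N + N ^ D * D * N)).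
  by rewrite leq_add2r leq_mul2r IH orbT.
rewrite -[(D.+1 ^ 2)%N]/(D.+1 * D.+1)%N -[(D ^ 2)%N]/(D * D)%N.
nia.
Qed.

Definition subword (A : finType) (D N : nat) (W : {ffun 'I_N -> A})
  (h : {ffun 'I_D -> 'I_N}) : {ffun 'I_D -> A} := [ffun l => W (h l)].

Section Words.
Variables (A : finType) (D N : nat).
Implicit Types (W : {ffun 'I_N -> A}) (h : {ffun 'I_D -> 'I_N})
  (u : {ffun 'I_D -> A}).

(** A sample of distinct positions of a random word is a random shorter word; the
positions that are not read contribute the total mass each. *)
Lemma sum_words_sample (S : comNzRingType) (y : A -> S)
    (G : {ffun 'I_D -> A} -> S) h : injective h ->
  \sum_(W : {ffun 'I_N -> A}) (\prod_j y (W j)) * G (subword W h) =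
  (\sum_a y a) ^+ (N - D) * \sum_(u : {ffun 'I_D -> A}) (\prod_l y (u l)) * G u.
Proof.
move=> hinj.
rewrite (partition_big (fun W => subword W h) xpredT) //= big_distrr /=.
apply: eq_bigr => u _.
under eq_bigr => W /eqP -> do [].
rewrite -big_distrl mulrA; congr (_ * _).
(* The words W with subword u form a product set: position h l must carry the
   letter u l, and the other positions are free. *)
pose Q (j : 'I_N) : pred A := [pred a | [forall l, (h l == j) ==> (a == u l)]].
transitivity (\sum_(W in family Q) \prod_j y (W j)).
  apply: eq_bigl => W; apply/eqP/familyP => [e j|WQ].
    by apply/forallP => l; apply/implyP => /eqP <-; rewrite -e ffunE.
  apply/ffunP => l; rewrite ffunE; apply/eqP.
  by have /forallP/(_ l) := WQ (h l); rewrite eqxx.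
rewrite -(bigA_distr_big_dep _ (fun _ a => y a)) /=.
rewrite (bigID (fun j => j \in h @: 'I_D)) /= mulrC; congr (_ * _).
  transitivity (\prod_(j in ~: (h @: 'I_D)) \sum_a y a).
    apply: eq_big => [j|j jh]; first by rewrite inE.
    apply: eq_bigl => a; apply/forallP => l; apply/implyP => /eqP e.
    by case/negP: jh; rewrite -e imset_f.
  rewrite prodr_const cardsCs setCK card_imset //.
  by rewrite !card_ord.
rewrite big_imset /=; last by move=> a b _ _; apply: hinj.
apply: eq_bigr => l _.
rewrite (big_pred1 (u l)) // => a /=.
apply/forallP/idP => [/(_ l)|/eqP -> l']; first by rewrite eqxx.
by apply/implyP => /eqP/hinj ->.
Qed.

(** Sampling with replacement, by contrast, evaluates the form G at the letter
counts of the word W. *)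
Lemma sum_all_samples (R : comNzRingType) (G : {ffun 'I_D -> A} -> R) W :
  \sum_(h : {ffun 'I_D -> 'I_N}) G (subword W h) =
  \sum_(u : {ffun 'I_D -> A}) (\prod_l (\sum_j (W j == u l)%:R)) * G u.
Proof.
under [RHS]eq_bigr => u _ do rewrite bigA_distr_bigA big_distrl /=.
rewrite exchange_big /=; apply: eq_bigr => h _.
rewrite (bigD1 (subword W h)) //= big1 ?mul1r => [|l _].
  rewrite big1 ?addr0 // => u /eqP ne.
  have [/forallP e|] := boolP [forall l, W (h l) == u l].
    by case: ne; apply/ffunP => l; rewrite ffunE (eqP (e l)).
  rewrite negb_forall => /existsP[l /negPf el].
  by rewrite (bigD1 l) //= el !mul0r.
by rewrite ffunE eqxx.
Qed.

Lemma card_injections :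
  #|[pred h : {ffun 'I_D -> 'I_N} | injectiveb h]| = (N ^_ D)%N.
Proof.
have := card_inj_ffuns 'I_D 'I_N; rewrite !card_ord => <-.
by apply: eq_card => h; rewrite !inE.
Qed.

Lemma card_noninjections :
  #|[pred h : {ffun 'I_D -> 'I_N} | ~~ injectiveb h]| = (N ^ D - N ^_ D)%N.
Proof.
have := cardC [pred h : {ffun 'I_D -> 'I_N} | injectiveb h].
rewrite card_injections card_ffun !card_ord => <-.
by rewrite addKn; apply: eq_card => h; rewrite !inE.
Qed.

Lemma sum_noninjections_le (R : realFieldType) (B : R)
    (G : {ffun 'I_D -> 'I_N} -> R) : (0 < N)%N ->
  (forall h, `|G h| <= B) ->
  `|\sum_(h : {ffun 'I_D -> 'I_N} | ~~ injectiveb h) G h|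
    <= B * (D ^ 2)%:R / N%:R * N%:R ^+ D.
Proof.
move=> N0 GB.
have [h0|h0] := leqP D 0.
  rewrite big_pred0 ?normr0 => [|h].
    by move: h0; rewrite leqn0 => /eqP ->; rewrite mulr0 mul0r mul0r.
  apply/negbTE/negPn/injectiveP => i; have := ltn_ord i.
  by move: h0; rewrite leqn0 => /eqP {2}->.
have B0 : 0 <= B.
  have i0 : 'I_N by exact: (Ordinal N0).
  by apply: le_trans (GB [ffun _ => i0]).
apply: le_trans (ler_norm_sum _ _ _) _.
apply: (@le_trans _ _ (\sum_(h : {ffun 'I_D -> 'I_N} | ~~ injectiveb h) B)).
  by apply: ler_sum => h _; exact: GB.
have -> : \sum_(h : {ffun 'I_D -> 'I_N} | ~~ injectiveb h) B
  = B * (N ^ D - N ^_ D)%:R.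
  by rewrite -card_noninjections sumr_const mulr_natr.
rewrite -!mulrA ler_wpM2l // mulrCA mulrC ler_pdivlMr ?ltr0n //.
rewrite -natrX -!natrM ler_nat.
by rewrite expn_sub_ffact_le.
Qed.

End Words.

Lemma sum_frequencies (R : realFieldType) (A : finType) (N : nat)
  (W : {ffun 'I_N -> A}) : (0 < N)%N ->
  \sum_a (\sum_j (W j == a)%:R / N%:R) = 1 :> R.
Proof.
move=> N0; rewrite exchange_big /=.
transitivity (\sum_(j < N) N%:R^-1 : R); last first.
  by rewrite sumr_const card_ord -[LHS]mulr_natl divff // pnatr_eq0 -lt0n.
apply: eq_bigr => j _.
rewrite (bigD1 (W j)) //= eqxx mul1r [X in _ + X]big1 ?addr0 // => a /negPf.
by rewrite eq_sym => ->; rewrite mul0r.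
Qed.

Lemma sum_injections_ge0 (R : realFieldType) (A : finType) (D N : nat)
    (B delta : R) (G : {ffun 'I_D -> A} -> R) (W : {ffun 'I_N -> A}) :
    (0 < N)%N -> B * (D ^ 2)%:R <= delta * N%:R ->
    (forall u, `|G u| <= B) ->
    (forall q : A -> R, (forall a, 0 <= q a) -> \sum_a q a = 1 ->
       delta <= \sum_(u : {ffun 'I_D -> A}) (\prod_l q (u l)) * G u) ->
  0 <= \sum_(h : {ffun 'I_D -> 'I_N} | injectiveb h) G (subword W h).
Proof.
move=> N0 hN GB Gq.
have NR : 0 < N%:R :> R by rewrite ltr0n.
pose q a : R := \sum_j (W j == a)%:R / N%:R.
have all_ge :
    delta * N%:R ^+ D <= \sum_(h : {ffun 'I_D -> 'I_N}) G (subword W h).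
  rewrite sum_all_samples -ler_pdivlMr ?exprn_gt0 // big_distrl /=.
  have -> : \sum_(u : {ffun 'I_D -> A})
      (\prod_l (\sum_j (W j == u l)%:R)) * G u / N%:R ^+ D =
      \sum_(u : {ffun 'I_D -> A}) (\prod_l q (u l)) * G u.
    apply: eq_bigr => u _; rewrite mulrAC; congr (_ * _).
    rewrite -exprVn -[D in _ ^+ D]card_ord -prodr_const -big_split /=.
    by apply: eq_bigr => l _; rewrite big_distrl.
  apply: Gq; last exact: sum_frequencies.
  by move=> a; apply: sumr_ge0 => j _; rewrite divr_ge0 ?ler0n.
move: all_ge; rewrite (bigID (fun h : {ffun 'I_D -> 'I_N} => injectiveb h)) /=.
have := sum_noninjections_le N0 (fun h => GB (subword W h)).
set x := \sum_(h | ~~ _) _; set z := \sum_(h | _) _ => hx hz.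
have : B * (D ^ 2)%:R / N%:R * N%:R ^+ D <= delta * N%:R ^+ D.
  by rewrite ler_wpM2r ?exprn_ge0 ?ler0n // ler_pdivrMr.
move: hx; rewrite ler_norml => /andP[_]; lra.
Qed.

(** Pólya's theorem for forms given by a bounded statistic G. Averaging G over
injective samples does not change the form, and makes its coefficients close to
its values at the letter frequencies. The lower bound on N does not involve the
alphabet A, and the identity holds in any ring S. *)
Lemma polya_words (R : realFieldType) (S : comNzRingType)
    (phi : {rmorphism R -> S}) (A : finType) (D N : nat)
    (B delta : R) (G : {ffun 'I_D -> A} -> R) (y : A -> S) :
    (0 < N)%N -> (D <= N)%N -> B * (D ^ 2)%:R <= delta * N%:R ->
    (forall u, `|G u| <= B) ->
    (forall q : A -> R, (forall a, 0 <= q a) -> \sum_a q a = 1 ->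
       delta <= \sum_(u : {ffun 'I_D -> A}) (\prod_l q (u l)) * G u) ->
  exists2 c : {ffun 'I_N -> A} -> R, forall W, 0 <= c W &
    (\sum_a y a) ^+ (N - D) *
      (\sum_(u : {ffun 'I_D -> A}) (\prod_l y (u l)) * phi (G u)) =
    \sum_(W : {ffun 'I_N -> A}) phi (c W) * \prod_j y (W j).
Proof.
move=> N0 DN hN GB Gq.
pose c W : R := (\sum_(h : {ffun 'I_D -> 'I_N} | injectiveb h) G (subword W h))
  / (N ^_ D)%:R.
exists c => [W|].
  by rewrite divr_ge0 ?ler0n // (sum_injections_ge0 W N0 hN GB Gq).
have nz : (N ^_ D)%:R != 0 :> R by rewrite pnatr_eq0 -lt0n ffact_gt0.
under [RHS]eq_bigr => W _ do rewrite /c mulrC rmorphM rmorph_sum mulrA.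
rewrite -big_distrl /=.
under [X in _ = X * _]eq_bigr => W _ do rewrite big_distrr /=.
rewrite exchange_big /=.
under [X in _ = X * _]eq_bigr => h /injectiveP hinj
  do rewrite (sum_words_sample y (fun u => phi (G u)) hinj).
rewrite sumr_const card_injections -[X in _ = X * _]mulr_natr.
by rewrite -(rmorph_nat phi) -[RHS]mulrA -rmorphM divff // rmorph1 mulr1.
Qed.

Lemma sum_words_prod (S : comNzRingType) (A : finType) (D : nat) (y : A -> S)
    (g : 'I_D -> A -> S) :
  \sum_(u : {ffun 'I_D -> A}) (\prod_l y (u l)) * \prod_l g l (u l) =
  \prod_l \sum_a y a * g l a.
Proof.
rewrite bigA_distr_bigA; apply: eq_bigr => u _.
by rewrite big_split.
Qed.

(** * Coin tosses *)

Section Coins.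
Variables (R : realFieldType) (r : nat).
Implicit Type e : {ffun 'I_r -> bool}.

Definition coin (b : bool) : R := (-1) ^+ b.

Definition coin_mean e : R := (\sum_j coin (e j)) / r%:R.

(** The k-th elementary symmetric mean of the tosses: unlike the k-th power of
their mean, it is an unbiased estimate of the k-th power of the bias. *)
Definition coin_moment (k : nat) e : R :=
  (\sum_(h : {ffun 'I_k -> 'I_r} | injectiveb h) \prod_l coin (e (h l)))
    / (r ^_ k)%:R.

Lemma normr_coin_prod (k : nat) (F : 'I_k -> bool) :
  `|\prod_l coin (F l)| = 1.
Proof.
by rewrite normr_prod big1 // => l _; rewrite normrX normrN1 expr1n.
Qed.

Lemma normr_sum_injections_le (k : nat) e :
  `|\sum_(h : {ffun 'I_k -> 'I_r} | injectiveb h) \prod_l coin (e (h l))|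
    <= (r ^_ k)%:R.
Proof.
apply: le_trans (ler_norm_sum _ _ _) _.
under eq_bigr => h _ do rewrite (normr_coin_prod (fun l => e (h l))).
by rewrite sumr_const card_injections.
Qed.

Lemma coin_moment_norm_le1 (k : nat) e : (k <= r)%N -> `|coin_moment k e| <= 1.
Proof.
move=> kr; rewrite normrM normfV normr_nat ler_pdivrMr ?mul1r.
  exact: normr_sum_injections_le.
by rewrite ltr0n ffact_gt0.
Qed.

Lemma coin_mean_norm_le1 e : `|coin_mean e| <= 1.
Proof.
have [r0|r0] := posnP r.
  by rewrite /coin_mean (_ : r%:R = 0 :> R) ?invr0 ?mulr0 ?normr0 // r0.
rewrite normrM normfV normr_nat ler_pdivrMr ?ltr0n // mul1r.
apply: le_trans (ler_norm_sum _ _ _) _.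
under eq_bigr => j _ do rewrite normrX normrN1 expr1n.
by rewrite sumr_const card_ord.
Qed.

(** The same comparison of injective samples with all samples, now for the tosses
of one coin. *)
Lemma coin_moment_approx (k : nat) e : (0 < r)%N -> (k <= r)%N ->
  `|coin_moment k e - coin_mean e ^+ k| <= 2 * (k ^ 2)%:R / r%:R.
Proof.
move=> r0 kr; have r0R : 0 < r%:R :> R by rewrite ltr0n.
have f0 : 0 < (r ^_ k)%:R :> R by rewrite ltr0n ffact_gt0.
have p0 : 0 < r%:R ^+ k :> R by rewrite exprn_gt0.
have all_eq : (\sum_j coin (e j)) ^+ k =
    \sum_(h : {ffun 'I_k -> 'I_r}) \prod_l coin (e (h l)).
  by rewrite -[k in LHS]card_ord -prodr_const bigA_distr_bigA.
rewrite /coin_mean expr_div_n all_eq.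
rewrite (bigID (fun h : {ffun 'I_k -> 'I_r} => injectiveb h)) /= /coin_moment.
have := normr_sum_injections_le k e.
have := @sum_noninjections_le k r R 1
  (fun h : {ffun 'I_k -> 'I_r} => \prod_l coin (e (h l))) r0.
set a := \sum_(h | injectiveb _) _; set b := \sum_(h | ~~ _) _.
move=> hb ha.
have {}hb : `|b| <= 1 * (k ^ 2)%:R / r%:R * r%:R ^+ k.
  by apply: hb => h; rewrite normr_coin_prod.
have le := ffact_le_expn r k.
have hPF : r%:R ^+ k - (r ^_ k)%:R <= (k ^ 2)%:R / r%:R * r%:R ^+ k :> R.
  rewrite mulrAC ler_pdivlMr // -natrX -natrB // -!natrM ler_nat.
  exact: expn_sub_ffact_le.
have hPF0 : 0 <= r%:R ^+ k - (r ^_ k)%:R :> R.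
  by rewrite subr_ge0 -natrX ler_nat.
move: f0 p0 ha hb hPF hPF0; rewrite mul1r.
set F := (r ^_ k)%:R; set P := r%:R ^+ k; set t := _ / _.
move=> f0 p0 ha hb hPF hPF0.
have -> : a / F - (a + b) / P = (a / F * (P - F) - b) / P.
  by field; rewrite !gt_eqF.
rewrite normrM [ `|P^-1|]gtr0_norm ?invr_gt0 // ler_pdivrMr //.
apply: le_trans (ler_normB _ _) _.
have -> : 2 * (k ^ 2)%:R / r%:R * P = t * P + t * P by rewrite /t; ring.
apply: lerD => //; apply: le_trans hPF.
rewrite normrM (ger0_norm hPF0) ler_piMl // normrM normfV (gtr0_norm f0).
by rewrite ler_pdivrMr ?mul1r.
Qed.

(** A toss b has weight (s + b x) / 2, so the total weight is s and the mean toss is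
x; for s = 1 this is a coin of bias x. *)
Lemma coin_moment_unbiased (S : comNzRingType) (phi : {rmorphism R -> S})
    (k : nat) (s x : S) : (k <= r)%N ->
  \sum_(e : {ffun 'I_r -> bool})
     (\prod_j (phi 2^-1 * (s + phi (coin (e j)) * x))) * phi (coin_moment k e)
  = s ^+ (r - k) * x ^+ k.
Proof.
move=> kr; have nz : (r ^_ k)%:R != 0 :> R by rewrite pnatr_eq0 -lt0n ffact_gt0.
pose y b := phi 2^-1 * (s + phi (coin b) * x).
have half : phi 2^-1 + phi 2^-1 = 1.
  by rewrite -rmorphD -[RHS](rmorph1 phi); congr (phi _); field.
have ys : \sum_b y b = s.
  rewrite big_bool /= /y /coin expr0 expr1 rmorphN rmorph1.
  transitivity ((phi 2^-1 + phi 2^-1) * s); first by ring.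
  by rewrite half mul1r.
have yx : \sum_b y b * phi (coin b) = x.
  rewrite big_bool /= /y /coin expr0 expr1 rmorphN rmorph1.
  transitivity ((phi 2^-1 + phi 2^-1) * x); first by ring.
  by rewrite half mul1r.
have key : forall h : {ffun 'I_k -> 'I_r}, injective h ->
    \sum_(e : {ffun 'I_r -> bool})
      (\prod_j y (e j)) * phi (\prod_l coin (e (h l))) = s ^+ (r - k) * x ^+ k.
  move=> h hinj.
  transitivity (\sum_(e : {ffun 'I_r -> bool})
      (\prod_j y (e j)) * \prod_l phi (coin (subword e h l))).
    apply: eq_bigr => e _; congr (_ * _); rewrite rmorph_prod.
    by apply: eq_bigr => l _; rewrite ffunE.
  rewrite (sum_words_sample y (fun u => \prod_l phi (coin (u l))) hinj) ys.
  rewrite (sum_words_prod y (fun _ b => phi (coin b))) yx.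
  by rewrite prodr_const card_ord.
transitivity (\sum_(h : {ffun 'I_k -> 'I_r} | injectiveb h)
    (s ^+ (r - k) * x ^+ k * phi (r ^_ k)%:R^-1)).
  under eq_bigr => e _ do rewrite /coin_moment rmorphM rmorph_sum mulrA
    big_distrr big_distrl /=.
  rewrite exchange_big /=; apply: eq_bigr => h /injectiveP hinj.
  by rewrite -big_distrl /= key.
rewrite sumr_const card_injections -mulrnAr -mulr_natr.
by rewrite -(rmorph_nat phi) -rmorphM mulVf // rmorph1 mulr1.
Qed.

End Coins.

(** * Distributions with small defect are close to the sphere *)

Lemma young_norm (R : realFieldType) (a eta : R) : 0 < eta ->
  `|a| <= eta + a ^+ 2 / eta.
Proof.
move=> e0; rewrite -real_normK ?num_real //; set b := `|a|.
have -> : eta + b ^+ 2 / eta = (eta ^+ 2 + b ^+ 2) / eta.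
  by field; rewrite gt_eqF.
rewrite ler_pdivlMr //.
have := sqr_ge0 (eta - b); have := sqr_ge0 eta; have := sqr_ge0 b; nra.
Qed.

(** With the sign of x_i = +- sqrt w chosen as that of v, the left-hand side is the
total of q (tau - x_i)^2 over an index. If w u = v^2 it is (sqrt u - w)^2, which
is at most |u - w^2|; the last term pays for the difference. *)
Lemma sign_defect (R : rcfType) (w u v eta : R) :
  0 <= w -> 0 <= u -> v ^+ 2 <= w * u -> 0 < eta ->
  u + w ^+ 2 - 2 * (Num.sqrt w * `|v|)
    <= `|u - w ^+ 2| + (eta * w + (w * u - v ^+ 2) / eta).
Proof.
move=> w0 u0 vwu e0.
set a := Num.sqrt w * `|v|.
have a0 : 0 <= a by rewrite mulr_ge0 ?sqrtr_ge0.
have a2 : a ^+ 2 = w * v ^+ 2.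
  by rewrite exprMn sqr_sqrtr // real_normK ?num_real.
set m := Num.min u (w ^+ 2).
have m0 : 0 <= m by rewrite le_min u0 sqr_ge0.
have mm : u + w ^+ 2 - `|u - w ^+ 2| = 2 * m.
  by rewrite /m; case: (lerP u (w ^+ 2)) => h; ring.
have m2 : m ^+ 2 <= w ^+ 2 * u.
  have h1 : m <= u by rewrite ge_min lexx.
  have h2 : m <= w ^+ 2 by rewrite ge_min lexx orbT.
  by rewrite [m ^+ 2]expr2; apply: ler_pM.
set z := w * u - v ^+ 2.
have z0 : 0 <= z by rewrite subr_ge0.
set k := eta * w + z / eta.
have k0 : 0 <= k.
  by apply: addr_ge0; [apply: mulr_ge0|apply: divr_ge0] => //; apply: ltW.
have k4 : 4 * (w * z) <= k ^+ 2.
  rewrite -subr_ge0.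
  have -> : k ^+ 2 - 4 * (w * z) = (eta * w - z / eta) ^+ 2.
    by rewrite /k; field; rewrite gt_eqF.
  exact: sqr_ge0.
have wz : w * z = w ^+ 2 * u - a ^+ 2 by rewrite a2 /z; ring.
(* If 2 m > 2 a + k, then 4 m^2 > 4 a^2 + k^2, against m^2 <= a^2 + w z. *)
suff : 2 * m - 2 * a <= k by lra.
rewrite leNgt; apply/negP => lt.
have : (k + 2 * a) ^+ 2 < (2 * m) ^+ 2.
  by rewrite ltr_pXn2r ?nnegrE //; nra.
nra.
Qed.

Section PlugIn.
Variables (R : rcfType) (n : nat) (T : finType).
Variables (tau : T -> R) (q : 'I_n -> T -> R).
Hypothesis tau1 : forall t, `|tau t| <= 1.
Hypothesis q0 : forall i t, 0 <= q i t.
Hypothesis q1 : \sum_i \sum_t q i t = 1.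

Lemma average_const (c : R) : \sum_i \sum_t q i t * c = c.
Proof.
rewrite -[RHS]mul1r -q1 mulr_suml.
by apply: eq_bigr => i _; rewrite mulr_suml.
Qed.

Definition local_moment (g : T -> R) (i : 'I_n) : R := \sum_t q i t * g t.

Local Notation w := (fun i => \sum_t q i t).
Local Notation M k := (local_moment (fun t => tau t ^+ k)).

Lemma mass_ge0 i : 0 <= w i.
Proof. by apply: sumr_ge0. Qed.

Lemma mass_le1 i : w i <= 1.
Proof.
rewrite -q1 (bigD1 i) //= lerDl; apply: sumr_ge0 => j _; exact: mass_ge0.
Qed.

Lemma moment_cauchy_schwarz i : M 1%N i ^+ 2 <= w i * M 2%N i.
Proof.
have : 0 <= \sum_t \sum_t' q i t * q i t' * (tau t - tau t') ^+ 2.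
  apply: sumr_ge0 => t _; apply: sumr_ge0 => t' _.
  by rewrite mulr_ge0 ?sqr_ge0 ?mulr_ge0.
have -> : \sum_t \sum_t' q i t * q i t' * (tau t - tau t') ^+ 2
   = M 2%N i * w i - 2 * (M 1%N i * M 1%N i) + w i * M 2%N i.
  rewrite /local_moment !big_distrl /= big_distrr /= -sumrB -big_split /=.
  apply: eq_bigr => t _.
  rewrite !big_distrr /= -sumrB -big_split /=.
  by apply: eq_bigr => t' _; ring.
rewrite expr2; lra.
Qed.

(** The form that vanishes on the weights of a genuine point, where M k is
x_i^(k+2). *)
Definition defect : R :=
  \sum_i (w i ^+ 3 - w i * M 2%N i - M 1%N i ^+ 2 + M 4%N i).

Definition spread : R := \sum_i (w i * M 2%N i - M 1%N i ^+ 2).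

Definition mismatch : R :=
  \sum_i \sum_t q i t * (tau t ^+ 2 - w i) ^+ 2.

Lemma defectE : defect = mismatch + spread.
Proof.
rewrite /defect /mismatch /spread -big_split /=; apply: eq_bigr => i _.
have -> : \sum_t q i t * (tau t ^+ 2 - w i) ^+ 2 =
    M 4%N i - 2 * w i * M 2%N i + w i ^+ 2 * w i.
  have e : w i ^+ 2 * w i = \sum_t q i t * w i ^+ 2 by rewrite -mulr_suml mulrC.
  rewrite e /local_moment; set W := \sum_t q i t.
  rewrite mulr_sumr -sumrB -big_split /=.
  by apply: eq_bigr => t _; ring.
ring.
Qed.

(** The sign is that of the first moment; a zero moment must still give a square
root of the mass, so that the point is on the sphere. *)
Definition nearby_point (i : 'I_n) : R :=
  if M 1%N i < 0 then - Num.sqrt (w i) else Num.sqrt (w i).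

Local Notation x := nearby_point.

Lemma nearby_point_sqr i : x i ^+ 2 = w i.
Proof.
by rewrite /nearby_point; case: ifP => _; rewrite ?sqrrN sqr_sqrtr ?mass_ge0.
Qed.

Lemma nearby_point_sphere : \sum_i x i ^+ 2 = 1.
Proof. by rewrite -q1; apply: eq_bigr => i _; exact: nearby_point_sqr. Qed.

Lemma nearby_point_norm_le1 i : `|x i| <= 1.
Proof.
rewrite -(@ler_pXn2r _ 2) ?nnegrE // real_normK ?num_real //.
by rewrite nearby_point_sqr expr1n mass_le1.
Qed.

Definition deviation : R := \sum_i \sum_t q i t * `|tau t - x i|.

Lemma deviation_ge0 : 0 <= deviation.
Proof.
apply: sumr_ge0 => i _; apply: sumr_ge0 => t _.
by rewrite mulr_ge0.
Qed.

(** The parameter eta replaces a square root: mismatch and spread bound the square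
of the deviation only through their own square roots, and |a| <= eta + a^2 / eta
keeps the estimate linear in the defect, which is what a penalty C * defect
needs. *)
Lemma square_deviation_le eta : 0 < eta ->
  \sum_i \sum_t q i t * (tau t - x i) ^+ 2 <= 2 * eta + defect / eta.
Proof.
move=> e0.
have mismatch_le : \sum_i \sum_t q i t * `|tau t ^+ 2 - w i| <= eta + mismatch / eta.
  rewrite -{1}(average_const eta) /mismatch mulr_suml -big_split /=.
  apply: ler_sum => i _; rewrite mulr_suml -big_split /=.
  apply: ler_sum => t _; rewrite -mulrA -mulrDr ler_wpM2l //.
  exact: young_norm.
have H2 i : \sum_t q i t * (tau t - x i) ^+ 2 <=
    \sum_t q i t * `|tau t ^+ 2 - w i|
    + (eta * w i + (w i * M 2%N i - M 1%N i ^+ 2) / eta).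
  have -> : \sum_t q i t * (tau t - x i) ^+ 2 =
      M 2%N i + w i ^+ 2 - 2 * (Num.sqrt (w i) * `|M 1%N i|).
    have -> : Num.sqrt (w i) * `|M 1%N i| = x i * M 1%N i.
      rewrite /nearby_point; case: ltrP => h.
        by rewrite (ltr0_norm h); ring.
      by rewrite (ger0_norm h).
    transitivity (M 2%N i + x i ^+ 2 * w i - 2 * x i * M 1%N i).
      rewrite /local_moment !mulr_sumr -big_split -sumrB /=.
      by apply: eq_bigr => t _; ring.
    by rewrite nearby_point_sqr; ring.
  apply: le_trans (sign_defect _ _ _ e0) _.
  - exact: mass_ge0.
  - by apply: sumr_ge0 => t _; rewrite mulr_ge0 ?sqr_ge0.
  - exact: moment_cauchy_schwarz.
  rewrite lerD2r.
  have -> : M 2%N i - w i ^+ 2 = \sum_t q i t * (tau t ^+ 2 - w i).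
    rewrite /local_moment [w i ^+ 2]expr2 mulr_suml -sumrB.
    by apply: eq_bigr => t _; ring.
  apply: le_trans (ler_norm_sum _ _ _) _.
  by apply: ler_sum => t _; rewrite normrM ger0_norm.
apply: le_trans (ler_sum _ (fun i _ => H2 i)) _.
rewrite !big_split /= -mulr_sumr q1 mulr1 -mulr_suml -/spread defectE mulrDl.
lra.
Qed.

Lemma deviation_le theta eta : 0 < theta -> 0 < eta ->
  deviation <= theta + (2 * eta + defect / eta) / theta.
Proof.
move=> t0 e0.
apply: le_trans
  (_ : theta + (\sum_i \sum_t q i t * (tau t - x i) ^+ 2) / theta <= _).
  rewrite -{1}(average_const theta) mulr_suml -big_split /=.
  apply: ler_sum => i _; rewrite mulr_suml -big_split /=.
  apply: ler_sum => t _; rewrite -mulrA -mulrDr ler_wpM2l //.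
  exact: young_norm.
rewrite lerD2l ler_wpM2r ?invr_ge0 ?(ltW t0) //.
exact: square_deviation_le.
Qed.

Lemma normr_expB_le (a b : R) (k : nat) : `|a| <= 1 -> `|b| <= 1 ->
  `|a ^+ k - b ^+ k| <= k%:R * `|a - b|.
Proof.
move=> a1 b1; elim: k => [|k IH]; first by rewrite !expr0 subrr normr0 mul0r.
have -> : a ^+ k.+1 - b ^+ k.+1 = a * (a ^+ k - b ^+ k) + (a - b) * b ^+ k.
  by rewrite !exprS; ring.
rewrite -[k.+1%:R]natr1 [leRHS]mulrDl mul1r; apply: le_trans (ler_normD _ _) _.
apply: lerD; rewrite normrM.
  by apply: le_trans IH; rewrite ler_piMl.
by rewrite ler_piMr // normrX exprn_ile1.
Qed.

Lemma moment_nearby_point (k : nat) (g : T -> R) (gam : R) :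
  (forall t, `|g t - tau t ^+ k| <= gam) ->
  `|\sum_i \sum_t q i t * g t - \sum_i x i ^+ k.+2|
    <= gam + k%:R * deviation.
Proof.
move=> gg.
have -> : \sum_i x i ^+ k.+2 = \sum_i \sum_t q i t * x i ^+ k.
  apply: eq_bigr => i _.
  by rewrite -addn2 exprD nearby_point_sqr mulrC mulr_suml.
rewrite -sumrB -{1}(average_const gam) /deviation mulr_sumr -big_split /=.
apply: le_trans (ler_norm_sum _ _ _) _; apply: ler_sum => i _.
rewrite -sumrB mulr_sumr -big_split /=.
apply: le_trans (ler_norm_sum _ _ _) _; apply: ler_sum => t _.
rewrite -mulrBr normrM ger0_norm //.
rewrite mulrCA -mulrDr ler_wpM2l //.
rewrite -(subrKA (tau t ^+ k)).
apply: le_trans (ler_normD _ _) _; apply: lerD; first exact: gg.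
exact: normr_expB_le (tau1 t) (nearby_point_norm_le1 i).
Qed.

Lemma normr_moment_le1 (g : T -> R) : (forall t, `|g t| <= 1) ->
  `|\sum_i \sum_t q i t * g t| <= 1.
Proof.
move=> g1; rewrite -q1.
apply: le_trans (ler_norm_sum _ _ _) _; apply: ler_sum => i _.
apply: le_trans (ler_norm_sum _ _ _) _; apply: ler_sum => t _.
by rewrite normrM ger0_norm // ler_piMr.
Qed.

Lemma power_sum_norm_le1 (k : nat) : `|\sum_i x i ^+ k.+2| <= 1.
Proof.
rewrite -nearby_point_sphere.
apply: le_trans (ler_norm_sum _ _ _) _; apply: ler_sum => i _.
rewrite -addn2 exprD normrM [ `|x i ^+ 2|]ger0_norm ?sqr_ge0 //.
by rewrite ler_piMl ?sqr_ge0 // normrX exprn_ile1 // nearby_point_norm_le1.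
Qed.

Lemma local_moment_close (k : nat) (g : T -> R) (gam : R) i :
  (forall t, `|g t - tau t ^+ k| <= gam) ->
  `|local_moment g i - M k i| <= gam * w i.
Proof.
move=> gg; rewrite /local_moment -sumrB mulr_sumr.
apply: le_trans (ler_norm_sum _ _ _) _; apply: ler_sum => t _.
by rewrite -mulrBr normrM ger0_norm // [gam * _]mulrC ler_wpM2l.
Qed.

Lemma local_moment_norm_le (g : T -> R) i :
  (forall t, `|g t| <= 1) -> `|local_moment g i| <= w i.
Proof.
move=> g1; apply: le_trans (ler_norm_sum _ _ _) _; apply: ler_sum => t _.
by rewrite normrM ger0_norm // ler_piMr.
Qed.

Lemma defect_close (g1 g2 g4 : T -> R) (gam : R) :
  (forall t, `|g1 t| <= 1) ->
  (forall t, `|g1 t - tau t ^+ 1| <= gam) ->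
  (forall t, `|g2 t - tau t ^+ 2| <= gam) ->
  (forall t, `|g4 t - tau t ^+ 4| <= gam) ->
  defect <= 4 * gam +
  \sum_i (w i ^+ 3 - w i * local_moment g2 i - local_moment g1 i ^+ 2
          + local_moment g4 i).
Proof.
move=> g1n a1 a2 a4.
rewrite -(average_const (4 * gam)) -big_split /=; apply: ler_sum => i _.
rewrite -mulr_suml.
have := local_moment_close i a1; have := local_moment_close i a2.
have := local_moment_close i a4; have := local_moment_norm_le i g1n.
have : `|M 1%N i| <= w i by apply: local_moment_norm_le => t; rewrite expr1.
have := mass_ge0 i; have := mass_le1 i.
move: (w i) (M 1%N i) (M 2%N i) (M 4%N i) (local_moment g1 i)
  (local_moment g2 i) (local_moment g4 i) => W m1 m2 m4 l1 l2 l4.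
rewrite !ler_norml => W1 W0 /andP[m1l m1u] /andP[l1l l1u] /andP[d4l d4u]
  /andP[d2l d2u] /andP[d1l d1u].
have gw : 0 <= gam * W by lra.
have h2 : W * l2 - W * m2 <= gam * W.
  have : W * (l2 - m2) <= W * (gam * W) by rewrite ler_wpM2l.
  have : W * (gam * W) <= gam * W by rewrite ler_piMl.
  lra.
have h1 : l1 ^+ 2 - m1 ^+ 2 <= 2 * (gam * W).
  have -> : l1 ^+ 2 - m1 ^+ 2 = (l1 - m1) * (l1 + m1) by ring.
  apply: le_trans (ler_norm _) _; rewrite normrM mulrC.
  apply: ler_pM => //; rewrite ler_norml; lra.
lra.
Qed.

End PlugIn.

(** * Lower bound on all distributions *)

Section TermLists.

(** A polynomial in the power sums is handled as a list of terms c * p_(k_1)...p_(k_l),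
with p an arbitrary sequence, so that moments of a distribution can be put in
place of power sums. *)
Definition eval_terms (R S : comNzRingType) (phi : R -> S) (p : nat -> S)
  (F : seq (R * seq nat)) : S := \sum_(t <- F) phi t.1 * \prod_(k <- t.2) p k.

Definition weighted_terms (R : Type) (d : nat) (F : seq (R * seq nat)) : bool :=
  all (fun t => all (leq 2) t.2 && (sumn t.2 == 2 * d)%N) F.

Lemma size_le_half_sumn (d : nat) (L : seq nat) :
  all (leq 2) L -> sumn L = (2 * d)%N -> (size L <= d)%N.
Proof.
suff : all (leq 2) L -> (2 * size L <= sumn L)%N.
  by move=> h L2 e; move: (h L2); rewrite e leq_pmul2l.
elim: L => //= k L IH /andP[k2 /IH]; lia.
Qed.

Lemma index_bounds (d k : nat) : (2 <= k)%N -> (k <= 2 * d)%N ->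
  [/\ (k - 2 <= 2 * d + 4)%N, (k = (k - 2).+2)%N & (k - 2 <= 2 * d)%N].
Proof. by move=> *; split; lia. Qed.

Lemma degree_factor_le (R : realFieldType) (d s : nat) (gam dev : R) :
  0 <= gam -> 0 <= dev -> (s <= d)%N ->
  s%:R * (gam + (2 * d)%:R * dev) <= (2 * d ^ 2)%:R * (gam + dev).
Proof.
move=> gam0 dev0 sd; rewrite mulrDr [leRHS]mulrDr mulrA -natrM.
by apply: lerD; rewrite ler_wpM2r // ler_nat; nia.
Qed.

Lemma mem_le_sumn (L : seq nat) k : k \in L -> (k <= sumn L)%N.
Proof.
elim: L => //= j L IH; rewrite inE => /orP[/eqP ->|/IH]; lia.
Qed.

Lemma normr_prodB_le (R : realDomainType) (L : seq nat) (a b : nat -> R) (c : R) :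
  (forall k, k \in L -> `|a k| <= 1) -> (forall k, k \in L -> `|b k| <= 1) ->
  (forall k, k \in L -> `|a k - b k| <= c) ->
  `|\prod_(k <- L) a k - \prod_(k <- L) b k| <= (size L)%:R * c.
Proof.
elim: L => [|k L IH] ha hb hc; first by rewrite !big_nil subrr normr0 mul0r.
have memL j : j \in L -> j \in k :: L by rewrite inE => ->; rewrite orbT.
have kL : k \in k :: L by rewrite inE eqxx.
rewrite !big_cons /= -[(size L).+1%:R]natr1 [leRHS]mulrDl mul1r.
set A := \prod_(j <- L) a j; set B := \prod_(j <- L) b j.
have -> : a k * A - b k * B = a k * (A - B) + (a k - b k) * B by ring.
apply: le_trans (ler_normD _ _) _; rewrite !normrM; apply: lerD.
  apply: (@le_trans _ _ `|A - B|); first by rewrite ler_piMl // ha.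
  by apply: IH => j /memL; [exact: ha | exact: hb | exact: hc].
apply: (@le_trans _ _ `|a k - b k|); last exact: hc.
rewrite ler_piMr // /B big_seq; elim/big_ind: _ => [|u v u1 v1|j /memL /hb //].
  by rewrite normr1.
by rewrite normrM mulr_ile1.
Qed.

End TermLists.

(** The defect makes up for what f may lose at a distribution that is not of the
form of a point. The family g k stands for estimates of tau^k with error gam; the
bounds are uniform in n and in the set T of outcomes at an index. *)
Lemma plugin_bound (R : rcfType) (d : nat) (eps : R) (F : seq (R * seq nat)) :
  0 < eps -> weighted_terms d F ->
  (forall n (x : 'I_n -> R), \sum_i x i ^+ 2 = 1 ->
     eps <= eval_terms idfun (fun k => \sum_i x i ^+ k) F) ->
  exists2 C : R, 0 <= C & exists2 gam : R, 0 < gam &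
  forall (n : nat) (T : finType) (tau : T -> R) (g : nat -> T -> R)
    (q : 'I_n -> T -> R),
  (forall t, `|tau t| <= 1) ->
  (forall k t, (k <= 2 * d + 4)%N -> `|g k t| <= 1) ->
  (forall k t, (k <= 2 * d + 4)%N -> `|g k t - tau t ^+ k| <= gam) ->
  (forall i t, 0 <= q i t) -> \sum_i \sum_t q i t = 1 ->
  eps / 2 <=
    eval_terms idfun (fun k => \sum_i \sum_t q i t * g (k - 2)%N t) F
    + C * \sum_i ((\sum_t q i t) ^+ 3
                  - (\sum_t q i t) * local_moment q (g 2%N) i
                  - local_moment q (g 1%N) i ^+ 2
                  + local_moment q (g 4%N) i).
Proof.
move=> e0 wF pos.
(* Lam is a Lipschitz constant of f in terms of its moments. With eta = theta^2 in
   deviation_le, the errors are 3 Lam theta = 3 eps / 8 from the deviation and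
   (Lam + 4 C) gam = eps / 8 from the estimates g, and C times the defect. *)
pose Lam : R := (2 * d ^ 2)%:R * (\sum_(t <- F) `|t.1|) + 1.
have S0 : 0 <= \sum_(t <- F) `|t.1| by apply: sumr_ge0.
have Lam0 : 0 < Lam by rewrite ltr_wpDl // mulr_ge0 ?ler0n.
pose theta := eps / (8 * Lam).
have th0 : 0 < theta by rewrite divr_gt0 // mulr_gt0.
pose C := Lam / theta ^+ 3.
have C0 : 0 <= C by rewrite divr_ge0 ?exprn_ge0 ?ltW.
pose gam := eps / (8 * (Lam + 4 * C)).
have den0 : 0 < Lam + 4 * C by lra.
have gam0 : 0 < gam by rewrite divr_gt0 // mulr_gt0.
exists C => //; exists gam => // n T tau g q tau1 g1 gapp q0 q1.
have dev0 := deviation_ge0 tau q0.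
have dle := deviation_le tau q0 q1 th0 (exprn_gt0 2 th0).
have k1 : (1 <= 2 * d + 4)%N by rewrite addn4.
have k2 : (2 <= 2 * d + 4)%N by rewrite addn4.
have k4 : (4 <= 2 * d + 4)%N by rewrite addn4.
have dcl := defect_close tau1 q0 q1 (g1 1%N ^~ k1)
  (gapp 1%N ^~ k1) (gapp 2%N ^~ k2) (gapp 4%N ^~ k4).
set x := nearby_point tau q.
have xs : \sum_i x i ^+ 2 = 1 by exact: nearby_point_sphere.
have := pos n x xs.
set dev := deviation tau q in dev0 dle.
set Z := \sum_i _ in dcl *.
have close : `|eval_terms idfun (fun k => \sum_i \sum_t q i t * g (k - 2)%N t) F
    - eval_terms idfun (fun k => \sum_i x i ^+ k) F| <= Lam * (gam + dev).
  rewrite /eval_terms -sumrB.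
  apply: le_trans (ler_norm_sum _ _ _) _.
  apply: (@le_trans _ _ (\sum_(t <- F) `|t.1| * ((2 * d ^ 2)%:R * (gam + dev)))).
    rewrite big_seq [leRHS]big_seq; apply: ler_sum => t tF.
    have /andP[t2 /eqP ts] := allP wF t tF.
    rewrite -mulrBr normrM ler_wpM2l //.
    have kP k : k \in t.2 -> [/\ (k - 2 <= 2 * d + 4)%N, (k = (k - 2).+2)%N
        & (k - 2 <= 2 * d)%N].
      move=> kt; have := mem_le_sumn kt; have := allP t2 _ kt; rewrite ts.
      exact: index_bounds.
    apply: le_trans (@normr_prodB_le _ _ _ _ (gam + (2 * d)%:R * dev) _ _ _) _.
    - by move=> k /kP[kd _ _]; apply: normr_moment_le1 => // t'; exact: g1.
    - by move=> k /kP[_ -> _]; exact: power_sum_norm_le1.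
    - move=> k /kP[kd kE kd'].
      have := moment_nearby_point tau1 q0 q1 (fun t' => gapp _ t' kd).
      rewrite -kE => /le_trans; apply.
      by rewrite lerD2l ler_wpM2r // ler_nat.
    exact: degree_factor_le (ltW gam0) dev0 (size_le_half_sumn t2 ts).
  rewrite -mulr_suml /Lam; set s := \sum_(t <- F) _ in S0 *.
  rewrite mulrCA mulrA mulrDl lerDl mul1r; lra.
move: close; rewrite ler_norml => /andP[close _] posx.
have dle2 : dev <= 3 * theta + defect tau q / theta ^+ 3.
  apply: le_trans dle _; rewrite le_eqVlt; apply/orP; left; apply/eqP.
  by field; rewrite gt_eqF.
have h1 : Lam * dev <= 3 * (eps / 8) + C * defect tau q.
  have -> : 3 * (eps / 8) + C * defect tau q
      = Lam * (3 * theta + defect tau q / theta ^+ 3).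
    by rewrite /C /theta; field; rewrite !gt_eqF.
  by rewrite ler_wpM2l // ltW.
have h2 : Lam * gam + 4 * C * gam = eps / 8.
  by rewrite /gam; field; rewrite gt_eqF.
have h3 : C * defect tau q <= 4 * C * gam + C * Z.
  have := ler_wpM2l C0 dcl; lra.
lra.
Qed.

(** * Sums of squares *)

Section SumsOfSquares.
Variable S : comNzRingType.
Implicit Types h : S.

Definition sos h : Prop := exists l : seq S, h = \sum_(q <- l) q ^+ 2.

Lemma sos0 : sos 0.
Proof. by exists [::]; rewrite big_nil. Qed.

Lemma sos_sqr h : sos (h ^+ 2).
Proof. by exists [:: h]; rewrite big_seq1. Qed.

Lemma sosD h1 h2 : sos h1 -> sos h2 -> sos (h1 + h2).
Proof. by move=> [l1 ->] [l2 ->]; exists (l1 ++ l2); rewrite big_cat. Qed.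

Lemma sos_sum (I : Type) (l : seq I) (P : pred I) (F : I -> S) :
  (forall i, P i -> sos (F i)) -> sos (\sum_(i <- l | P i) F i).
Proof. by move=> H; elim/big_ind: _ => //; [exact: sos0 | exact: sosD]. Qed.

Lemma sosM h1 h2 : sos h1 -> sos h2 -> sos (h1 * h2).
Proof.
move=> [l1 ->] [l2 ->]; rewrite mulr_suml; apply: sos_sum => a _.
rewrite mulr_sumr; apply: sos_sum => b _.
by rewrite -exprMn; exact: sos_sqr.
Qed.

Lemma sos_prod (I : Type) (l : seq I) (F : I -> S) :
  (forall i, sos (F i)) -> sos (\prod_(i <- l) F i).
Proof.
move=> H; elim/big_ind: _ => //; last exact: sosM.
by rewrite -(expr1n _ 2); exact: sos_sqr.
Qed.

Lemma sos_const (R : rcfType) (phi : {rmorphism R -> S}) (c : R) :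
  0 <= c -> sos (phi c).
Proof. by move=> /sqr_sqrtr <-; rewrite rmorphXn; exact: sos_sqr. Qed.

End SumsOfSquares.

(** * The sampled form *)

Section PaddedProducts.
Variables (R : comNzRingType) (A : finType) (D : nat).
Implicit Types (g : A -> R) (L : seq (A -> R)) (u : {ffun 'I_D -> A}).

(** Padding with the constant 1 gives all terms the same number D of samples, which
amounts to multiplying by powers of the total mass. *)
Definition padded_prod L u : R :=
  \prod_(l < D) nth (fun=> 1) L l (u l).

Lemma sum_padded_prod (S : comNzRingType) (phi : {rmorphism R -> S})
    (y : A -> S) L : (size L <= D)%N ->
  \sum_(u : {ffun 'I_D -> A}) (\prod_l y (u l)) * phi (padded_prod L u) =
  (\prod_(g <- L) \sum_a y a * phi (g a)) * (\sum_a y a) ^+ (D - size L).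
Proof.
move=> sL.
under [LHS]eq_bigr => u _ do rewrite /padded_prod rmorph_prod.
rewrite (sum_words_prod y (fun l a => phi (nth (fun=> 1) L l a))).
rewrite -(big_mkord xpredT (fun l => \sum_a y a * phi (nth (fun=> 1) L l a))).
rewrite (big_cat_nat (n := size L)) //=; congr (_ * _).
  by rewrite [RHS](big_nth (fun=> 1)).
rewrite -prodr_const_nat big_nat [RHS]big_nat; apply: eq_bigr => l /andP[sl _].
apply: eq_bigr => a _.
by rewrite nth_default // rmorph1 mulr1.
Qed.

End PaddedProducts.

Lemma padded_prod_norm_le (R : realDomainType) (A : finType) (D : nat)
    (g : A -> R) (L : seq (A -> R)) (u : {ffun 'I_D.+1 -> A}) :
  (forall j a, `|nth (fun=> 1) L j a| <= 1) ->
  `|padded_prod (g :: L) u| <= `|g (u ord0)|.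
Proof.
move=> L1; rewrite /padded_prod big_ord_recl /= normrM ler_piMr //.
rewrite normr_prod; apply: prodr_ile1 => j _; rewrite normr_ge0 /=.
exact: L1.
Qed.

Lemma sum_pairs (S : nmodType) (I J : finType) (F : I * J -> S) :
  \sum_a F a = \sum_i \sum_j F (i, j).
Proof. by rewrite pair_big /=; apply: eq_bigr => -[]. Qed.

Lemma coin_moment0 (R : realFieldType) (r : nat) (e : {ffun 'I_r -> bool}) :
  coin_moment R 0 e = 1.
Proof.
rewrite /coin_moment ffactn0 divr1.
under eq_bigr => h _ do rewrite big_ord0.
by rewrite sumr_const card_injections ffactn0.
Qed.

Section SampledForm.
Variables (R : realType) (d n r : nat) (C : R) (F : seq (R * seq nat)).
Hypothesis C0 : 0 <= C.
Hypothesis wF : weighted_terms d F.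
Hypothesis rd : (2 * d + 4 <= r)%N.

Local Notation letter := ('I_n * {ffun 'I_r -> bool})%type.
Local Notation D := d.+3.

Definition at_index (i : 'I_n) (k : nat) (a : letter) : R :=
  (a.1 == i)%:R * coin_moment R k a.2.

Definition index_factors (L : seq nat) : seq (letter -> R) :=
  [seq (fun a => coin_moment R (k - 2) a.2) | k <- L].

(** The statistic of the defect: two samples have the same index i if both factors
at_index i are nonzero, so sum_i w^3 is the probability that three samples agree,
and so on. *)
Definition defect_form (u : {ffun 'I_D -> letter}) : R :=
  \sum_i (padded_prod [:: at_index i 0; at_index i 0; at_index i 0] u
          - padded_prod [:: at_index i 0; at_index i 2] u
          - padded_prod [:: at_index i 1; at_index i 1] u
          + padded_prod [:: at_index i 4] u).

Definition sampled_form (u : {ffun 'I_D -> letter}) : R :=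
  \sum_(t <- F) t.1 * padded_prod (index_factors t.2) u + C * defect_form u.

Lemma at_index_norm_le1 i k a : (k <= r)%N -> `|at_index i k a| <= 1.
Proof.
move=> kr; rewrite normrM mulr_ile1 ?coin_moment_norm_le1 //.
by rewrite normr_nat lern1; case: (_ == _).
Qed.

Lemma at_index_norm_le i k a : (k <= r)%N ->
  `|at_index i k a| <= (a.1 == i)%:R.
Proof.
move=> kr; rewrite normrM normr_nat ler_piMr ?ler0n //.
exact: coin_moment_norm_le1.
Qed.

(** The bound does not grow with n: for a given word only the index of its first
letter contributes. *)
Lemma defect_form_norm_le u : `|defect_form u| <= 4.
Proof.
have rk k : (k <= 4)%N -> (k <= r)%N.
  by move=> k4; exact: leq_trans k4 (leq_trans (leq_addl _ _) rd).
have nthP (L : seq (letter -> R)) : (forall j, (j < size L)%N ->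
    forall a, `|nth (fun=> 1) L j a| <= 1) ->
    forall j a, `|nth (fun=> 1) L j a| <= 1.
  move=> H j a; case: (ltnP j (size L)) => h; first exact: H.
  by rewrite nth_default // normr1.
have bound i k L : (k <= 4)%N -> (forall j, (j < size L)%N ->
    forall a, `|nth (fun=> 1) L j a| <= 1) ->
    `|padded_prod (at_index i k :: L) u| <= ((u ord0).1 == i)%:R.
  move=> k4 HL; apply: le_trans (padded_prod_norm_le _ _ (nthP _ HL)) _.
  exact: at_index_norm_le (rk _ k4).
have one i k a : (k <= 4)%N -> `|at_index i k a| <= 1.
  by move=> k4; apply: at_index_norm_le1; exact: rk.
apply: le_trans (_ : \sum_i ((u ord0).1 == i)%:R * 4 <= 4); last first.
  rewrite -mulr_suml (bigD1 (u ord0).1) //= eqxx big1 ?addr0 ?mul1r // => i.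
  by rewrite eq_sym => /negPf ->.
apply: le_trans (ler_norm_sum _ _ _) _; apply: ler_sum => i _.
have b0 : `|padded_prod [:: at_index i 0; at_index i 0; at_index i 0] u|
    <= ((u ord0).1 == i)%:R.
  by apply: (bound i 0%N) => // -[|[|]] //= _ a; exact: one.
have b2 : `|padded_prod [:: at_index i 0; at_index i 2] u|
    <= ((u ord0).1 == i)%:R.
  by apply: (bound i 0%N) => // -[|] //= _ a; exact: one.
have b1 : `|padded_prod [:: at_index i 1; at_index i 1] u|
    <= ((u ord0).1 == i)%:R.
  by apply: (bound i 1%N) => // -[|] //= _ a; exact: one.
have b4 : `|padded_prod [:: at_index i 4] u| <= ((u ord0).1 == i)%:R.
  exact: (bound i 4%N).
move: b0 b2 b1 b4; rewrite !ler_norml.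
move=> /andP[? ?] /andP[? ?] /andP[? ?] /andP[? ?].
apply/andP; split; lra.
Qed.

Lemma sampled_form_norm_le u :
  `|sampled_form u| <= \sum_(t <- F) `|t.1| + C * 4.
Proof.
apply: le_trans (ler_normD _ _) _; apply: lerD; last first.
  by rewrite normrM ger0_norm // ler_wpM2l // defect_form_norm_le.
apply: le_trans (ler_norm_sum _ _ _) _.
rewrite big_seq [leRHS]big_seq; apply: ler_sum => t tF.
rewrite normrM ler_piMr // normr_prod; apply: prodr_ile1 => j _.
rewrite normr_ge0 /=.
have /andP[t2 /eqP ts] := allP wF t tF.
case: (ltnP j (size t.2)) => h; last first.
  by rewrite nth_default ?size_map // normr1.
rewrite (nth_map 0%N) //; apply: coin_moment_norm_le1.
have := mem_le_sumn (mem_nth 0%N h); rewrite ts => le.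
by apply: leq_trans (leq_subr _ _) (leq_trans le (leq_trans (leq_addr _ _) rd)).
Qed.

Lemma sum_sampled_form (S : comNzRingType) (phi : {rmorphism R -> S})
    (y : letter -> S) :
  let E k := \sum_a y a * phi (coin_moment R k a.2) in
  let M i k := \sum_e y (i, e) * phi (coin_moment R k e) in
  let T := \sum_a y a in
  \sum_(u : {ffun 'I_D -> letter}) (\prod_l y (u l)) * phi (sampled_form u) =
  \sum_(t <- F) phi t.1 * ((\prod_(k <- t.2) E (k - 2)%N) * T ^+ (D - size t.2))
  + phi C * \sum_i (M i 0%N ^+ 3 * T ^+ d - M i 0%N * M i 2%N * T ^+ d.+1
                    - M i 1%N ^+ 2 * T ^+ d.+1 + M i 4%N * T ^+ d.+2).
Proof.
move=> E M T.
have at_sum i k : \sum_a y a * phi (at_index i k a) = M i k.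
  rewrite sum_pairs (bigD1 i) //= [X in _ + X]big1 ?addr0 => [|j /negPf ji].
    by apply: eq_bigr => e _; rewrite /at_index eqxx mul1r.
  by apply: big1 => e _; rewrite /at_index ji mul0r rmorph0 mulr0.
have padE L : (size L <= D)%N ->
    \sum_(u : {ffun 'I_D -> letter}) (\prod_l y (u l)) * phi (padded_prod L u) =
    (\prod_(g <- L) \sum_a y a * phi (g a)) * T ^+ (D - size L).
  by move=> sL; exact: sum_padded_prod.
under [LHS]eq_bigr => u _ do rewrite rmorphD rmorphM mulrDr.
rewrite big_split /=; congr (_ + _).
  under [LHS]eq_bigr => u _ do rewrite rmorph_sum mulr_sumr.
  rewrite exchange_big /= big_seq [RHS]big_seq; apply: eq_bigr => t tF.
  have /andP[t2 /eqP ts] := allP wF t tF.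
  under [LHS]eq_bigr => u _ do rewrite rmorphM mulrCA.
  rewrite -mulr_sumr padE ?size_map; last first.
    by apply: leq_trans (size_le_half_sumn t2 ts) _; rewrite -addn3 leq_addr.
  by rewrite big_map.
under [LHS]eq_bigr => u _ do rewrite mulrCA.
rewrite -mulr_sumr; congr (_ * _).
under [LHS]eq_bigr => u _ do rewrite /defect_form rmorph_sum mulr_sumr.
rewrite exchange_big /=; apply: eq_bigr => i _.
under [LHS]eq_bigr => u _ do rewrite rmorphD !rmorphB mulrDr !mulrBr.
rewrite big_split !sumrB /= !padE //= !big_cons !big_nil !at_sum !mulr1.
by rewrite !subSS !subn0 -expr2 -exprS.
Qed.

End SampledForm.

(** * Weights that are sums of squares *)

Section LetterWeights.
Variables (R : rcfType) (S : comNzRingType) (phi : {rmorphism R -> S}).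
Variables (n r : nat) (x : 'I_n -> S) (s : S).
Hypothesis s2 : s ^+ 2 = \sum_i x i ^+ 2.

Local Notation letter := ('I_n * {ffun 'I_r -> bool})%type.

Definition letter_weight (a : letter) : S :=
  x a.1 ^+ 2 * \prod_j (phi 2^-1 * (s + phi (coin R (a.2 j)) * x a.1)).

Lemma sum_letter_weight i k : (k <= r)%N ->
  \sum_e letter_weight (i, e) * phi (coin_moment R k e) =
  s ^+ (r - k) * x i ^+ k.+2.
Proof.
move=> kr; rewrite -addn2 addnC exprD mulrCA.
rewrite -(coin_moment_unbiased phi s (x i) kr).
by rewrite mulr_sumr; apply: eq_bigr => e _; rewrite mulrA.
Qed.

(** Each of the r factors s + c x_i is paired with one factor s: since s^2 is the sum
of the x_j^2, 2 s (s + c x_i) = (s + c x_i)^2 + sum_(j != i) x_j^2 for c = +-1. *)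
Lemma sos_letter_weight a : sos (s ^+ r * letter_weight a).
Proof.
rewrite /letter_weight mulrCA; apply: sosM; first exact: sos_sqr.
have -> : s ^+ r = \prod_(j < r) s by rewrite prodr_const card_ord.
rewrite -big_split /=; apply: sos_prod => j.
set c := phi (coin R _).
have c2 : c ^+ 2 = 1.
  by rewrite -rmorphXn /coin -exprM mulnC exprM sqrrN !expr1n rmorph1.
set h := phi 2^-1.
have hh : h + h = 1.
  by rewrite -rmorphD -[RHS](rmorph1 phi); congr (phi _); field.
have -> : s * (h * (s + c * x a.1)) =
    h ^+ 2 * ((s + c * x a.1) ^+ 2 + (s ^+ 2 - x a.1 ^+ 2)).
  have -> : x a.1 ^+ 2 = c ^+ 2 * x a.1 ^+ 2 by rewrite c2 mul1r.
  transitivity ((h + h) * h * (s * (s + c * x a.1))).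
    by rewrite hh; ring.
  by ring.
apply: sosM; first exact: sos_sqr.
apply: sosD; first exact: sos_sqr.
rewrite s2 (bigD1 a.1) //= addrAC subrr add0r.
by apply: sos_sum => i _; exact: sos_sqr.
Qed.

End LetterWeights.

(** As the terms of f all have degree 2 d, padding and tosses multiply each of them
by the same power of s, whatever its number of factors. *)
Lemma prod_expr_homogeneous (S : comNzRingType) (s : S) (r d m : nat)
    (p : nat -> S) (L : seq nat) :
  all (leq 2) L -> sumn L = (2 * d)%N -> (size L <= m)%N -> (2 * d <= r)%N ->
  (\prod_(k <- L) (s ^+ (r - (k - 2)) * p k)) * (s ^+ r.+2) ^+ (m - size L) =
  s ^+ (r.+2 * m - 2 * d) * \prod_(k <- L) p k.
Proof.
move=> L2 sL Lm dr.
rewrite big_split /= mulrAC; congr (_ * _).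
have [e [eE eL]] : exists e, \prod_(k <- L) s ^+ (r - (k - 2)) = s ^+ e /\
    (e + sumn L = r.+2 * size L)%N.
  have : {in L, forall k, (k <= r)%N}.
    by move=> k /mem_le_sumn; rewrite sL => /leq_trans; apply.
  elim: (L) L2 => [|k L' IH] /=; first by exists 0%N; rewrite big_nil muln0.
  move=> /andP[k2 L2] kr.
  have [|e [eE eL]] := IH L2.
    by move=> j jL; apply: kr; rewrite inE jL orbT.
  have kr' := kr k (mem_head _ _).
  exists (r - (k - 2) + e)%N; rewrite big_cons eE -exprD; split => //.
  rewrite mulnS -eL; lia.
rewrite eE -exprM -exprD; congr (s ^+ _).
have le : (r.+2 * size L <= r.+2 * m)%N by rewrite leq_mul2l Lm orbT.
rewrite mulnBr -eL sL; move: le; rewrite -eL sL; lia.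
Qed.

Lemma exponent_balance (N D d r : nat) : (d <= D)%N -> (D <= N)%N ->
  (2 * (N * r.+1 - d) = r * N + (r.+2 * (N - D) + (r.+2 * D - 2 * d)))%N.
Proof.
move=> /subnKC <- /subnKC <-; move: (D - d)%N => j; move: (N - _)%N => e.
rewrite addKn !mulSn !mulnS !mulnDl !mulnDr [(d * r)%N]mulnC [(j * r)%N]mulnC.
by rewrite [(e * r)%N]mulnC; lia.
Qed.

(** The exponent K depends on d, eps and F only: the penalty C and the accuracy gam
come from [plugin_bound], then the number r of tosses from gam, then the word
length N from Pólya's theorem. *)
Lemma uniform_sos (R : realType) (d : nat) (eps : R) (F : seq (R * seq nat)) :
  0 < eps -> weighted_terms d F ->
  (forall n (x : 'I_n -> R), \sum_i x i ^+ 2 = 1 ->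
     eps <= eval_terms idfun (fun k => \sum_i x i ^+ k) F) ->
  exists K : nat, forall (S : comNzRingType) (phi : {rmorphism R -> S})
    (n : nat) (x : 'I_n -> S) (s : S), s ^+ 2 = \sum_i x i ^+ 2 ->
    sos (s ^+ (2 * K) * eval_terms phi (fun k => \sum_i x i ^+ k) F).
Proof.
move=> e0 wF pos.
have [C C0 [gam gam0 bound]] := plugin_bound e0 wF pos.
pose m := (2 * d + 4)%N.
pose r := (m + Num.Def.archi_bound (2 * (m ^ 2)%:R / gam))%N.
have mr : (m <= r)%N by exact: leq_addr.
have r0 : (0 < r)%N by apply: leq_trans mr; rewrite /m addn4.
have approx (k : nat) (e : {ffun 'I_r -> bool}) : (k <= m)%N ->
    `|coin_moment R k e - coin_mean R e ^+ k| <= gam.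
  move=> km; apply: le_trans (coin_moment_approx R e r0 (leq_trans km mr)) _.
  rewrite ler_pdivrMr ?ltr0n // [leRHS]mulrC -ler_pdivrMr //.
  apply: (@le_trans _ _ (2 * (m ^ 2)%:R / gam)).
    by rewrite ler_pM2r ?invr_gt0 // ler_pM2l // ler_nat leq_exp2r.
  apply: (le_trans (ltW (archi_boundP _))).
    by rewrite divr_ge0 ?mulr_ge0 ?ler0n // ltW.
  by rewrite ler_nat leq_addl.
pose B := \sum_(t <- F) `|t.1| + C * 4.
have B0 : 0 <= B by rewrite addr_ge0 ?mulr_ge0 // sumr_ge0.
pose D := d.+3.
pose N := (D + Num.Def.archi_bound (B * (D ^ 2)%:R / (eps / 2)))%N.
have e20 : 0 < eps / 2 by rewrite divr_gt0.
have DN : (D <= N)%N by exact: leq_addr.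
have N0 : (0 < N)%N by [].
have hN : B * (D ^ 2)%:R <= eps / 2 * N%:R.
  rewrite [leRHS]mulrC -ler_pdivrMr //.
  apply: (le_trans (ltW (archi_boundP _))).
    by apply: divr_ge0; [apply: mulr_ge0 | apply: ltW].
  by rewrite ler_nat leq_addl.
exists (N * r.+1 - d)%N => S phi n x s s2.
pose y := letter_weight phi (r := r) x s.
have Gq (q : 'I_n * {ffun 'I_r -> bool} -> R) : (forall a, 0 <= q a) ->
    \sum_a q a = 1 ->
    eps / 2 <= \sum_(u : {ffun 'I_D -> 'I_n * {ffun 'I_r -> bool}})
      (\prod_l q (u l)) * sampled_form C F u.
  move=> q0 q1.
  have := sum_sampled_form C wF (idfun : {rmorphism R -> R}) q.
  move=> /= ->.
  have := bound n _ (coin_mean R (r := r)) (coin_moment R (r := r))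
    (fun i e => q (i, e)).
  move=> /(_ (coin_mean_norm_le1 R (r := r))).
  move=> /(_ (fun k t km => coin_moment_norm_le1 R t (leq_trans km mr))).
  move=> /(_ (fun k t km => approx k t km) (fun i t => q0 (i, t))).
  rewrite -sum_pairs => /(_ q1) /le_trans; apply.
  rewrite le_eqVlt; apply/orP; left; apply/eqP.
  rewrite /eval_terms q1; congr (_ + _ * _).
    apply: eq_bigr => t _; rewrite expr1n mulr1; congr (_ * _).
    by apply: eq_bigr => k _; rewrite sum_pairs.
  apply: eq_bigr => i _; rewrite !expr1n !mulr1.
  have -> : \sum_e q (i, e) * coin_moment R 0 e = \sum_e q (i, e).
    by apply: eq_bigr => e _; rewrite coin_moment0 mulr1.
  by [].
have [c c0] := polya_words phi y N0 DN hN (sampled_form_norm_le C0 wF mr) Gq.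
rewrite (sum_sampled_form C wF phi y).
have M_E i k : (k <= m)%N -> \sum_e y (i, e) * phi (coin_moment R k e) =
    s ^+ (r - k) * x i ^+ k.+2.
  by move=> km; apply: sum_letter_weight; exact: leq_trans km mr.
have E_E k : (k <= m)%N -> \sum_a y a * phi (coin_moment R k a.2) =
    s ^+ (r - k) * \sum_i x i ^+ k.+2.
  move=> km; rewrite sum_pairs mulr_sumr; apply: eq_bigr => i _; exact: M_E.
have T_E : \sum_a y a = s ^+ r.+2.
  rewrite -addn2 exprD s2 -[r in s ^+ r]subn0 -E_E //.
  by apply: eq_bigr => a _; rewrite coin_moment0 rmorph1 mulr1.
rewrite T_E.
(* On the weights of a point all four terms of the defect are equal. *)
rewrite [X in _ + phi C * X]big1 ?mulr0 ?addr0; last first.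
  move=> i _; rewrite !M_E /m ?addn4 //.
  have [r' ->] : exists r', r = (r' + 4)%N.
    by exists (r - 4)%N; rewrite subnK // (leq_trans _ mr) // /m addn4.
  rewrite subn0 !addnK !addnS addn0 !subSS subn0 !exprS.
  by ring.
have -> : \sum_(t <- F) phi t.1 *
    ((\prod_(k <- t.2) \sum_a y a * phi (coin_moment R (k - 2) a.2))
     * s ^+ r.+2 ^+ (d.+3 - size t.2)) =
   s ^+ (r.+2 * D - 2 * d) * eval_terms phi (fun k => \sum_i x i ^+ k) F.
  rewrite /eval_terms mulr_sumr big_seq [RHS]big_seq; apply: eq_bigr => t tF.
  have /andP[t2 /eqP ts] := allP wF t tF.
  have sz := size_le_half_sumn t2 ts.
  rewrite [RHS]mulrCA; congr (_ * _).
  rewrite -(@prod_expr_homogeneous _ s r d D _ t.2) //; last first.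
  - by apply: leq_trans mr; exact: leq_addr.
  - by apply: leq_trans sz _; rewrite /D -addn3 leq_addr.
  congr (_ * _); rewrite big_seq [RHS]big_seq; apply: eq_bigr => k kt.
  have := mem_le_sumn kt; have := allP t2 _ kt; rewrite ts => k2 kd.
  have [km kE _] := index_bounds k2 kd.
  by rewrite E_E // -kE.
move=> key.
have -> : s ^+ (2 * (N * r.+1 - d)) = s ^+ (r * N) * (s ^+ r.+2 ^+ (N - D)
    * s ^+ (r.+2 * D - 2 * d)).
  rewrite -exprM -!exprD; congr (s ^+ _).
  by apply: exponent_balance => //; rewrite /D -addn3 leq_addr.
rewrite -!mulrA key mulr_sumr; apply: sos_sum => W _.
rewrite mulrCA; apply: sosM; first exact: sos_const.
(* The factor s^(r N) offers one s to each of the r tosses of each letter. *)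
have -> : s ^+ (r * N) = \prod_(j < N) s ^+ r.
  by rewrite prodr_const card_ord exprM.
rewrite -big_split; apply: sos_prod => j; exact: sos_letter_weight.
Qed.

(** * Adjoining a square root of the second power sum *)

Lemma rmorph_linear_sqr (A S : comNzRingType) (p : A)
    (iota : {rmorphism {poly A} -> S}) (a b : A) :
  iota 'X ^+ 2 = iota p%:P ->
  iota (a%:P + b *: 'X) ^+ 2 =
  iota ((a ^+ 2 + p * b ^+ 2)%:P + (a * b *+ 2) *: 'X).
Proof.
move=> X2; rewrite -!mul_polyC rmorphD rmorphM.
rewrite polyCD [(p * _)%:P]polyCM !polyC_exp polyCMn [(a * b)%:P]polyCM.
rewrite [RHS]rmorphD [X in _ = X + _]rmorphD !expr2 !mulr2n !rmorphM rmorphD.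
move: X2; rewrite !rmorphM expr2 => X2.
by rewrite -X2; ring.
Qed.

Section QuadraticExtension.
Variables (A : comNzRingType) (p : A).

Local Notation h := ('X^2 - p%:P : {poly A}).
Local Notation ext := {poly %/ h}.

Lemma mk_monic_quadratic : mk_monic h = h.
Proof.
by rewrite /mk_monic size_XnsubC // monicXnsubC.
Qed.

Lemma quadratic_root : (in_qpoly h 'X) ^+ 2 = in_qpoly h p%:P.
Proof.
rewrite -rmorphXn; apply/eqP; rewrite -subr_eq0 -rmorphB; apply/eqP.
apply: val_inj; rewrite /= mk_monic_quadratic.
by rewrite Pdiv.RingMonic.rmodpp // monicXnsubC.
Qed.

(** An element of the extension is a + b s, and the part of its square without s is
a^2 + p b^2. *)
Lemma sos_quadratic (g : A) : sos (in_qpoly h g%:P) ->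
  exists l : seq (A * A), g = \sum_(q <- l) (q.1 ^+ 2 + p * q.2 ^+ 2).
Proof.
have small (f : {poly A}) : (size f < 3)%N -> in_qpoly h f = f :> {poly A}.
  by move=> sf; rewrite in_qpoly_small // mk_monic_quadratic size_XnsubC.
have small_lin (a b : A) : (size (a%:P + b *: 'X)%R < 3)%N.
  apply: leq_ltn_trans (size_polyD _ _) _; rewrite gtn_max.
  rewrite (leq_ltn_trans (size_polyC_leq1 _)) //=.
  by rewrite (leq_ltn_trans (size_scale_leq _ _)) // size_polyX.
have coef0sqr (q : ext) :
    (q ^+ 2 : ext)`_0 = (q : {poly A})`_0 ^+ 2 + p * (q : {poly A})`_1 ^+ 2.
  have qE : q = in_qpoly h (((q : {poly A})`_0)%:P + (q : {poly A})`_1 *: 'X).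
    apply: val_inj; apply: etrans (esym (small _ (small_lin _ _))).
    apply/polyP => -[|[|i]]; rewrite !(coefD, coefC, coefZ, coefX) //=.
    - by rewrite mulr0 addr0.
    - by rewrite mulr1 add0r.
    rewrite mulr0 addr0 nth_default //.
    have sm : size (mk_monic h) = 3%N by rewrite mk_monic_quadratic size_XnsubC.
    by have := size_mk_monic q; rewrite [X in (_ < X)%N]sm ltnS => /leq_trans; apply.
  move: (q : {poly A})`_0 (q : {poly A})`_1 qE => a b ->.
  have -> : in_qpoly h (a%:P + b *: 'X) ^+ 2 =
      in_qpoly h ((a ^+ 2 + p * b ^+ 2)%:P + (a * b *+ 2) *: 'X).
    exact: (@rmorph_linear_sqr A ext p (in_qpoly h) a b quadratic_root).
  rewrite small; last exact: small_lin.
  by rewrite coefD coefC coefZ coefX mulr0 addr0.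
move=> [l gl]; exists [seq ((q : {poly A})`_0, (q : {poly A})`_1) | q : ext <- l].
have gE : g = (in_qpoly h g%:P : {poly A})`_0.
  by rewrite small ?coefC // (leq_ltn_trans (size_polyC_leq1 _)).
apply: etrans gE _; rewrite gl poly_of_qpoly_sum coef_sum big_map.
by apply: eq_bigr => q _; exact: coef0sqr.
Qed.

End QuadraticExtension.

(** * Symmetric functions as lists of terms *)

Section TermsOfSymmetricFunctions.
Variable R : comNzRingType.
Implicit Types (m : cmonom nat) (f : symfun R).

Definition monom_indices m : seq nat :=
  flatten [seq nseq (m i) i.+1 | i <- finsupp m].

Lemma subst_monomE (S : comNzRingType) (p : nat -> S) m :
  subst_monom p m = \prod_(k <- monom_indices m) p k.
Proof.
rewrite /subst_monom big_flatten big_map; apply: eq_bigr => i _.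
by rewrite big_nseq -Monoid.iteropE.
Qed.

Lemma monom_indicesP m k : k \in monom_indices m ->
  exists2 i, i \in finsupp m & k = i.+1.
Proof.
by move=> /flatten_mapP[i im]; rewrite mem_nseq => /andP[_ /eqP ->]; exists i.
Qed.

Definition symfun_terms f : seq (R * seq nat) :=
  [seq (monalg.mcoeff m f, monom_indices m) | m <- monalg.msupp f].

Lemma mmap_subst_monomE (S : comNzRingType) (phi : R -> S) (p : nat -> S) f :
  monalg.mmap phi (subst_monom p) f = eval_terms phi p (symfun_terms f).
Proof.
rewrite /monalg.mmap /eval_terms big_map; apply: eq_bigr => m _.
by rewrite subst_monomE.
Qed.

Lemma rmorph_eval_terms (S S' : comNzRingType) (psi : {rmorphism S -> S'})
    (phi : R -> S) (p : nat -> S) F :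
  psi (eval_terms phi p F) = eval_terms (psi \o phi) (psi \o p) F.
Proof.
rewrite rmorph_sum; apply: eq_bigr => t _.
by rewrite rmorphM rmorph_prod.
Qed.

Local Notation power_sums n := (fun k => \sum_(j < n) 'X_j ^+ k : {mpoly R[n]}).

Lemma power_sum_homog n k : (power_sums n k) \is k.-homog.
Proof.
apply: rpred_sum => j _; have := @dhomogX n R mdeg 1%N U_(j)%MM.
rewrite /= mdeg1 eqxx => /(dhomogMn k).
by rewrite mul1n.
Qed.

Lemma prod_power_sums_homog n (L : seq nat) :
  \prod_(k <- L) power_sums n k \is (sumn L).-homog.
Proof.
elim: L => [|k L IH]; first by rewrite big_nil dhomog1.
by rewrite big_cons /=; apply: dhomogM IH; exact: power_sum_homog.
Qed.

(** Homogeneity is a property of the truncations, so f may a priori have terms of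
weight other than e. They lie in other homogeneous components of the truncation
and cancel there. *)
Lemma trunc_homogeneous_part n e f : trunc n f \is e.-homog ->
  trunc n f = eval_terms (@mpolyC n R) (power_sums n)
    [seq t <- symfun_terms f | sumn t.2 == e].
Proof.
move=> /pihomog_dE <-; rewrite /trunc mmap_subst_monomE /eval_terms.
rewrite raddf_sum big_filter [RHS]big_mkcond /=; apply: eq_bigr => t _.
rewrite mul_mpolyC linearZ /=; case: eqP => [<-|/eqP ne].
  by rewrite pihomog_dE ?prod_power_sums_homog.
by rewrite (pihomog_ne0 ne) ?scaler0 // prod_power_sums_homog.
Qed.

Definition finseq_of n (x : 'I_n -> R) : finseq R :=
  [fsfun j in (@nat_of_ord n @` 'I_n)%fset => oapp x 0 (insub j) | 0].

Lemma sum_finseq_of n (x : 'I_n -> R) k :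
  \sum_(j <- finsupp (finseq_of x)) finseq_of x j ^+ k.+1 = \sum_i x i ^+ k.+1.
Proof.
rewrite (big_fset_incl _ (finsupp_sub _ _ _)) => [|j _]; last first.
  by rewrite memNfinsupp => /eqP ->; rewrite expr0n.
rewrite big_imfset /=; last by move=> i j _ _; exact: val_inj.
rewrite big_enum /=; apply: eq_bigr => i _.
rewrite fsfunE ifT; last by apply/imfsetP; exists i.
by rewrite insubT //= => ?; congr (x _ ^+ _); exact: val_inj.
Qed.

Lemma eval_power_sums (S : comNzRingType) n (psi : {rmorphism {mpoly R[n]} -> S})
    F :
  psi (eval_terms (@mpolyC n R) (power_sums n) F) =
  eval_terms (psi \o @mpolyC n R) (fun k => \sum_j psi 'X_j ^+ k) F.
Proof.
rewrite rmorph_eval_terms; apply: eq_bigr => t _; congr (_ * _).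
apply: eq_bigr => k _ /=; rewrite rmorph_sum.
by apply: eq_bigr => j _; rewrite rmorphXn.
Qed.

Lemma meval_power_sums n (x : 'I_n -> R) F :
  (eval_terms (@mpolyC n R) (power_sums n) F).@[x] =
  eval_terms idfun (fun k => \sum_i x i ^+ k) F.
Proof.
rewrite eval_power_sums; apply: eq_bigr => t _ /=; rewrite mevalC.
congr (_ * _); apply: eq_bigr => k _; apply: eq_bigr => j _.
by rewrite mevalXU.
Qed.

Lemma seval_finseq_of n (x : 'I_n -> R) f :
  seval (finseq_of x) f = (trunc n f).@[x].
Proof.
rewrite /seval /trunc !mmap_subst_monomE meval_power_sums.
rewrite /eval_terms !big_map; apply: eq_bigr => m _ /=; congr (_ * _).
rewrite big_seq [RHS]big_seq; apply: eq_bigr => _ /monom_indicesP[i _ ->].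
exact: sum_finseq_of.
Qed.

End TermsOfSymmetricFunctions.

(** * Uniform sums of squares *)

Unset Implicit Arguments.

Theorem theorem3p7 (R : realType) (d : nat) (eps : R) (f : symfun R)
  (hd : (0 < d)%N) (heps : 0 < eps)
  (hf : in_psums 2 (2 * d) f)
  (hhom : homogeneous (2 * d) f)
  (hpos : forall x : finseq R, seval x (psum R 2) = 1 -> eps <= seval x f) :
  exists k : nat, any_dim_sos (psum R 2 ^+ k * f).
Proof.
pose F := [seq t <- symfun_terms f | sumn t.2 == (2 * d)%N].
have truncE n : trunc n f = eval_terms (@mpolyC n R)
    (fun k => \sum_(j < n) 'X_j ^+ k) F.
  exact: trunc_homogeneous_part (hhom n).
have wF : weighted_terms d F.
  apply/allP => t; rewrite mem_filter => /andP[-> /mapP[m mf ->]] /=.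
  rewrite andbT; apply/allP => k /monom_indicesP[i im ->].
  by have /andP[] := hf m mf i im.
have pos n (x : 'I_n -> R) : \sum_i x i ^+ 2 = 1 ->
    eps <= eval_terms idfun (fun k => \sum_i x i ^+ k) F.
  move=> x1; have := hpos (finseq_of x).
  rewrite seval_psum // sum_finseq_of => /(_ x1).
  by rewrite seval_finseq_of truncE meval_power_sums.
have [K sosK] := uniform_sos heps wF pos.
exists K => n n0.
pose p : {mpoly R[n]} := \sum_(j < n) 'X_j ^+ 2.
pose h : {poly {mpoly R[n]}} := 'X^2 - p%:P.
pose iota : {rmorphism {mpoly R[n]} -> {poly %/ h}} := (in_qpoly h \o polyC).
have p2 : in_qpoly h 'X ^+ 2 = \sum_(j < n) iota 'X_j ^+ 2.
  rewrite quadratic_root -[LHS]/(iota p) rmorph_sum.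
  by apply: eq_bigr => j _; rewrite rmorphXn.
have := sosK _ (iota \o @mpolyC n R) n (fun j => iota 'X_j) _ p2.
have -> : trunc n (psum R 2 ^+ K * f) = p ^+ K * trunc n f.
  by rewrite /trunc rmorphM rmorphXn /= -/(trunc n _) trunc_psum.
have -> : in_qpoly h 'X ^+ (2 * K) * eval_terms (iota \o @mpolyC n R)
   (fun k => \sum_j iota 'X_j ^+ k) F = iota (p ^+ K * trunc n f).
  rewrite exprM quadratic_root -[in_qpoly h p%:P]/(iota p) rmorphM rmorphXn.
  by rewrite truncE eval_power_sums.
move=> /sos_quadratic[l ->].
apply: sos_sum => q _; apply: sosD; first exact: sos_sqr.
apply: sosM; last exact: sos_sqr.
by apply: sos_sum => j _; exact: sos_sqr.
Qed.
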